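(* For all cardinals $\lambda\ge 2$ and $\kappa\ge 1$, ${\sf U}(\lambda,\kappa)$ implies ${\sf L}(\lambda,\kappa)$.
   Context: Cut-and-choose game ${\sf UG}(\lambda,\kappa)$: White chooses a partition of $\kappa$ into $\lambda$ pieces and Black chooses one of these, $S_0$; then Black chooses a partition of $S_0$ into $\lambda$ pieces and White chooses one of these, $S_1$; then White partitions $S_1$ into $\lambda$ pieces and Black chooses one of these, $S_2$; and so on for $\omega$ innings. White wins if $\bigcap_{n<\omega}S_n\ne\emptyset$; else Black wins. Equivalently: White chooses $f_0\in{}^{\kappa}\lambda$; Black chooses $(\xi_0,f_1)\in\lambda\times{}^{\kappa}\lambda$; White chooses $(\xi_1,f_2)\in\lambda\times{}^{\kappa}\lambda$; Black chooses $(\xi_2,f_3)$; and so on. A play $f_0,(\xi_0,f_1),(\xi_1,f_2),(\xi_2,f_3),\dots$ is won by White iff there is an $\alpha<\kappa$ such that $f_n(\alpha)=\xi_n$ for all $n$. (So pieces of a partition may be empty.) ${\sf U}(\lambda,\kappa)$ is the statement: White has a winning strategy in ${\sf UG}(\lambda,\kappa)$. For $S\subseteq{}^{\omega}\lambda$, ${\sf GS}_{\lambda}(S)$ is the Gale-Stewart game in which players ONE and TWO alternately choose $\xi_0,\xi_1,\xi_2,\dots\in\lambda$ (ONE moving first) and ONE wins iff $(\xi_n:n<\omega)\in S$; otherwise TWO wins. Laver game: in ${\sf LG}(\lambda,\kappa)$ player ONE chooses $f_0:\kappa\to\lambda$, then TWO chooses $f_1:\kappa\to\lambda$, then ONE chooses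 $f_2:\kappa\to\lambda$, and so on for $\omega$ moves. ONE wins the play $(f_0,f_1,f_2,\dots)$ if for each $S\subseteq{}^{\omega}\lambda$ such that TWO does not have a winning strategy in ${\sf GS}_{\lambda}(S)$ there exists $\xi\in\kappa$ such that $(f_0(\xi),f_1(\xi),f_2(\xi),\dots)\in S$. Otherwise TWO wins. ${\sf L}(\lambda,\kappa)$ is the statement: ONE has a winning strategy in ${\sf LG}(\lambda,\kappa)$. *)

(* Defs.v *)
From mathcomp Require Import all_boot.
From mathcomp Require Import boolp classical_sets functions cardinality.

Set Implicit Arguments.
Unset Strict Implicit.
Unset Printing Implicit Defensive.

(* A two-player game of length omega with perfect information.  The moves are
   numbered 0, 1, 2, ...; ONE makes the even-numbered ones and TWO the
   odd-numbered ones.  The type of legal moves may depend on the number. *)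
Record game := Game {
  move : nat -> Type;
  ONE_wins : (forall n, move n) -> Prop }.

(* The partial plays (x_0, ..., x_(n-1)), as left-nested pairs. *)
Fixpoint position (G : game) (n : nat) : Type :=
  if n is m.+1 then (position G m * move G m)%type else unit.

Fixpoint prefix (G : game) (p : forall n, move G n) (n : nat) : position G n :=
  if n is m.+1 then (prefix p m, p m) else tt.

(* A strategy for the player who makes the moves numbered n with [turn n]. *)
Definition strategy (G : game) (turn : pred nat) : Type :=
  forall n, turn n -> position G n -> move G n.

Definition follows (G : game) (turn : pred nat) (s : strategy G turn)
    (p : forall n, move G n) : Prop :=
  forall n (tn : turn n), p n = s n tn (prefix p n).

Definition even (n : nat) : bool := ~~ odd n.

Definition ONE_has_winning_strategy (G : game) : Prop :=
  exists s : strategy G even, forall p, follows s p -> ONE_wins p.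

Definition TWO_has_winning_strategy (G : game) : Prop :=
  exists s : strategy G odd, forall p, follows s p -> ~ ONE_wins p.

(* Cardinals are represented by types: all games below depend on Lam and Kap
   only up to bijection. *)

(* White is player ONE.  Move 0 is f_0; move n.+1 is (xi_n, f_(n.+1)), where
   xi_n selects the piece of the partition f_n and f_(n.+1) is the next
   partition.  Pieces may be empty. *)
Definition cut_and_choose_move (Lam Kap : Type) (n : nat) : Type :=
  if n is _.+1 then (Lam * (Kap -> Lam))%type else Kap -> Lam.

Definition partition_of_move (Lam Kap : Type) (n : nat) :
    cut_and_choose_move Lam Kap n -> Kap -> Lam :=
  if n is _.+1 then snd else id.

Definition cut_and_choose (Lam Kap : Type) : game :=
  @Game (cut_and_choose_move Lam Kap) (fun p =>
    exists a : Kap, forall n : nat, partition_of_move (p n) a = (p n.+1).1).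

Definition U (Lam Kap : Type) : Prop := ONE_has_winning_strategy (cut_and_choose Lam Kap).

Definition Gale_Stewart (Lam : Type) (S : set (nat -> Lam)) : game :=
  @Game (fun=> Lam) S.

Definition Laver_game (Lam Kap : Type) : game :=
  @Game (fun=> Kap -> Lam) (fun f =>
    forall S : set (nat -> Lam), ~ TWO_has_winning_strategy (Gale_Stewart S) ->
    exists xi : Kap, S (fun n => f n xi)).

Definition L (Lam Kap : Type) : Prop := ONE_has_winning_strategy (Laver_game Lam Kap).

(* Main.v *)
Require Import Defs.
From mathcomp Require Import all_boot.
From mathcomp Require Import boolp classical_sets functions cardinality.

(** Fix a winning strategy [s] of White in the cut-and-choose game.  The
    partitions made by Black and the choices of pieces made by Black are
    independent data: a sequence [f] of functions (its odd terms) and a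
    sequence [xi] of labels (its even terms) together determine a play
    [W f xi] against [s].

    In the Laver game, ONE does not know the labels, and must replace all of
    White's possible next partitions by one function.  This is possible
    because different histories of labels concern disjoint pieces: a point [a]
    can only survive if Black's label in each inning is the value at [a] of
    White's partition.  So ONE's function at [a] is the value at [a] of the
    partition that [s] makes when Black's labels are the earlier values
    [f 0 a], [f 2 a], and so on.

    Why this wins: once the play [f] is complete, it gives TWO a strategy in
    [Gale_Stewart S], namely to answer with the labels that White chooses in
    [W f xi] while ONE's moves in that game serve as Black's labels.  If TWO has
    no winning strategy there, then some play [xi] with these answers is in
    [S].  As [s] wins, a point [a] survives in [W f xi], that is, its label is
    [xi n] in every partition of [W f xi].  By induction on [n] the functions
    [f n] agree at [a] with these partitions, so that [f n a = xi n] for all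
    [n], and [a] is the point that ONE needs. *)

Set Implicit Arguments.
Unset Strict Implicit.
Unset Printing Implicit Defensive.

Local Open Scope classical_set_scope.
Local Open Scope card_scope.

Section Run.
Variables (G : game) (turn : pred nat) (s : strategy G turn).

(** The opponent's moves are given as a whole play [p] rather than as a
    strategy: in both constructions below they are known in advance, and only
    the replies of [s] have to be computed. *)
Definition run_move (p : forall n, move G n) n (q : position G n) : move G n :=
  if pselect (turn n) is left tn then s tn q else p n.

Fixpoint run_position (p : forall n, move G n) n : position G n :=
  if n is m.+1 then (run_position p m, run_move p (run_position p m)) else tt.

Definition run (p : forall n, move G n) n : move G n :=
  run_move p (run_position p n).

Lemma prefix_run p n : Defs.prefix (run p) n = run_position p n.
Proof. by elim: n => //= n ->. Qed.

Lemma run_follows p : follows s (run p).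
Proof.
move=> n tn; rewrite prefix_run /run /run_move.
by case: pselect => // tn'; rewrite (bool_irrelevance tn' tn).
Qed.

Lemma run_opponent p n : ~~ turn n -> run p n = p n.
Proof. by move=> /negP ntn; rewrite /run /run_move; case: pselect. Qed.

Lemma eq_run_position p q n :
  (forall k, k < n -> ~~ turn k -> p k = q k) ->
  run_position p n = run_position q n.
Proof.
elim: n => //= n IHn eq_pq; rewrite IHn; last first.
  by move=> k lt_kn; apply: eq_pq; apply: ltnW.
congr (_, _); rewrite /run_move; case: pselect => // /negP ntn.
exact: eq_pq.
Qed.

Lemma eq_run p q n : turn n ->
  (forall k, k < n -> ~~ turn k -> p k = q k) -> run p n = run q n.
Proof.
move=> tn /eq_run_position eq_pq; rewrite /run /run_move eq_pq.
by case: pselect.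
Qed.

End Run.

Lemma eq_prefix (G : game) (p q : forall n, move G n) n :
  Defs.prefix p n = Defs.prefix q n -> forall k, k < n -> p k = q k.
Proof.
elim: n => //= n IHn [/IHn eq_pq eq_n] k; rewrite ltnS leq_eqVlt.
by case/predU1P => [->|/eq_pq].
Qed.

(** A rule [F] stated on whole plays is a strategy if it looks only at
    earlier moves.  This keeps positions out of the definitions of the two
    strategies built below.  The play [p0] makes every type of moves
    inhabited, as a strategy defined at all positions requires. *)
Lemma strategy_of_response (G : game) (turn : pred nat)
    (p0 : forall n, move G n) (F : forall n, (forall k, move G k) -> move G n) :
  (forall n p q, turn n -> (forall k, k < n -> p k = q k) -> F n p = F n q) ->
  exists s : strategy G turn,
    forall p, follows s p -> forall n, turn n -> p n = F n p.
Proof.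
move=> causalF.
have ex_move n (tn : turn n) (q : position G n) :
    exists x, forall p, Defs.prefix p n = q -> x = F n p.
  have [[p0' <-]|no_p] := pselect (exists p, Defs.prefix p n = q).
    exists (F n p0') => p /eq_prefix eq_p; apply: causalF => // k /eq_p.
    by move->.
  by exists (p0 n) => p eq_p; case: no_p; exists p.
exists (fun n tn q => sval (cid (ex_move n tn q))) => p sp n tn.
by rewrite {1}(sp n tn); case: cid => x /= xP; apply: xP.
Qed.

Section CutAndChooseToLaver.
Variables (Lam Kap : Type) (s : strategy (cut_and_choose Lam Kap) even).

(** The opening move is White's, so the term at 0 is a placeholder. *)
Definition black_moves (f : nat -> Kap -> Lam) (xi : nat -> Lam) n :
    move (cut_and_choose Lam Kap) n :=
  match n with
  | 0 => f 0
  | k.+1 => (xi k, f k.+1)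
  end.

Definition cc_play f xi := run s (black_moves f xi).

Definition cc_partition f xi n : Kap -> Lam :=
  partition_of_move (cc_play f xi n).

Lemma cc_partition_odd f xi n : odd n -> cc_partition f xi n = f n.
Proof.
move=> on; rewrite /cc_partition /cc_play run_opponent ?/even ?negbK //.
by case: n on.
Qed.

Lemma cc_label_even f xi n : even n -> (cc_play f xi n.+1).1 = xi n.
Proof. by move=> en; rewrite /cc_play run_opponent // /even /= negbK. Qed.

(** The two bounds differ because Black announces [xi k] together with
    [f k.+1], in move [k.+1]: White's move [n] answers the moves below [n]. *)
Lemma eq_cc_play f g xi zeta n : even n ->
  (forall k, k < n -> f k = g k) -> (forall k, k.+1 < n -> xi k = zeta k) ->
  cc_play f xi n = cc_play g zeta n.
Proof.
move=> en eq_f eq_xi; apply: eq_run => // -[|k] // ltkn _ /=.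
by rewrite eq_xi // eq_f.
Qed.

(** The rule by which ONE plays the Laver game: every point takes its own
    earlier values for Black's labels. *)
Definition laver_response n (f : nat -> Kap -> Lam) : Kap -> Lam :=
  fun a => cc_partition f (fun k => f k a) n a.

Lemma laver_response_causal n f g : even n ->
  (forall k, k < n -> f k = g k) -> laver_response n f = laver_response n g.
Proof.
move=> en eq_fg; apply: funext => a; rewrite /laver_response /cc_partition.
congr (partition_of_move _ a); apply: eq_cc_play => // k lt_kn.
by rewrite eq_fg // ltnW.
Qed.

(** Repeating White's labels is a strategy for TWO in [Gale_Stewart S]: the
    label in White's move [n.+1] depends only on the [xi k] with [k < n].  It
    is not a winning one, so some play that follows it is in [S]. *)
Lemma play_with_white_labels f (S : set (nat -> Lam)) : Lam ->
  ~ TWO_has_winning_strategy (Gale_Stewart S) ->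
  exists2 xi, S xi & forall n, odd n -> xi n = (cc_play f xi n.+1).1.
Proof.
move=> l0 no_win.
have [|t tP] := @strategy_of_response (Gale_Stewart S) odd (fun=> l0)
    (fun n xi => (cc_play f xi n.+1).1).
  move=> n xi zeta on eq_xi; rewrite (@eq_cc_play f f xi zeta) //.
  by rewrite /even /= negbK.
apply: contrapT => no_xi; apply: no_win; exists t => xi /tP xiP Sxi.
by apply: no_xi; exists xi.
Qed.

(** At a point [a] that survives in the play with labels [xi], the labels
    that [laver_response] computes from [a] are, by induction, those that Black
    chose, so that White's next partition is the same in both plays. *)
Lemma laver_values_at_survivor f xi a :
  (forall n, even n -> f n = laver_response n f) ->
  (forall n, cc_partition f xi n a = xi n) ->
  forall n, f n a = xi n.
Proof.
move=> fP xiP n; elim/ltn_ind: n => n IHn; rewrite -xiP.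
have [on|en] := boolP (odd n); first by rewrite cc_partition_odd.
rewrite [in LHS]fP // /laver_response /cc_partition.
congr (partition_of_move _ a); apply: eq_cc_play => // k lt_kn.
exact/IHn/ltnW.
Qed.

Lemma laver_response_wins f : Lam ->
  (forall p, follows s p -> ONE_wins p) ->
  (forall n, even n -> f n = laver_response n f) ->
  @ONE_wins (Laver_game Lam Kap) f.
Proof.
move=> l0 s_wins fP S /(play_with_white_labels f l0) [xi Sxi xi_odd].
have [a aP] := s_wins _ (run_follows s (black_moves f xi)).
exists a; suff -> : (fun n => f n a) = xi by [].
apply: funext; apply: laver_values_at_survivor => // n.
rewrite /cc_partition /cc_play aP.
have [on|en] := boolP (odd n); first by rewrite -xi_odd.
exact: cc_label_even.
Qed.

End CutAndChooseToLaver.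

Theorem theorem10 (Lam Kap : Type)
    (hLam : [set: 'I_2] #<= [set: Lam])
    (hKap : [set: 'I_1] #<= [set: Kap]) :
  U Lam Kap -> L Lam Kap.
Proof.
have [l0 _] : (exists l : Lam, True).
  apply: contrapT => no_l; move: hLam.
  have -> : [set: Lam] = set0.
    by apply/seteqP; split=> l // _; case: no_l; exists l.
  by rewrite card_le0 => /eqP/seteqP[/(_ ord0 I)].
case=> s s_wins.
have [|t tP] := @strategy_of_response (Laver_game Lam Kap) even
    (fun=> fun=> l0) (@laver_response Lam Kap s).
  exact: laver_response_causal.
by exists t => f /tP; apply: laver_response_wins.
Qed.
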